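(* Let $\delta\ge 2$ be an integer and let $G$ be a connected graph of even order $n$ with minimum degree $\delta$, where $n\ge \max\{8\delta-7,\ \tfrac13\delta^2+3\}$. If $$\rho_{\mathcal D}(G)\ \le\ \rho_{\mathcal D}\big(K_\delta\vee(K_{n-2\delta+1}\cup(\delta-1)K_1)\big),$$ then $G$ contains an even factor, unless $G\cong K_\delta\vee(K_{n-2\delta+1}\cup(\delta-1)K_1)$.
   Context: All graphs are finite, simple and undirected. An even factor of a graph $G$ is a spanning subgraph $F$ of $G$ such that $d_F(v)$ is a nonzero even number for every vertex $v\in V(G)$. For a connected graph $G$ on vertices $v_1,\dots,v_n$, the distance matrix $\mathcal D(G)$ is the $n\times n$ matrix whose $(i,j)$-entry is the distance (length of a shortest path) between $v_i$ and $v_j$; $\rho_{\mathcal D}(G)$ denotes its largest eigenvalue (the distance spectral radius). $K_m$ is the complete graph on $m$ vertices, $G_1\cup G_2$ is the disjoint union, $tK_1$ is the edgeless graph on $t$ vertices, and $G_1\vee G_2$ (join) is obtained from $G_1\cup G_2$ by adding all edges between $V(G_1)$ and $V(G_2)$. *)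

(* Defs.v *)
From HB Require Import structures.
From mathcomp Require Import all_boot all_order all_algebra all_fingroup.
From mathcomp Require Import boolp classical_sets reals.
Set Implicit Arguments. Unset Strict Implicit. Unset Printing Implicit Defensive.
Import Order.TTheory GRing.Theory Num.Theory.

Definition simple_graph n (e : rel 'I_n) : Prop := symmetric e /\ irreflexive e.

Definition deg n (e : rel 'I_n) (v : 'I_n) : nat := #|[set u | e v u]|.

Definition min_degree_is n (e : rel 'I_n) (d : nat) : Prop :=
  (forall v, d <= deg e v) /\ (exists v, deg e v = d).

Definition connected_graph n (e : rel 'I_n) : Prop := forall x y, connect e x y.

Fixpoint ball n (e : rel 'I_n) (k : nat) (x : 'I_n) : {set 'I_n} :=
  match k with
  | 0 => [set x]
  | k'.+1 => ball e k' x :|: \bigcup_(z in ball e k' x) [set w | e z w]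
  end.

(* graph distance: least k with y within k steps of x (for connected graphs
   this is attained for some k < n). *)
Definition dist n (e : rel 'I_n) (x y : 'I_n) : nat :=
  find (fun k => y \in ball e k x) (iota 0 n).

Definition distmx (R : realType) n (e : rel 'I_n) : 'M[R]_n :=
  \matrix_(i, j) ((dist e i j)%:R)%R.

(* largest eigenvalue of the distance matrix (real symmetric, so all
   eigenvalues are real and the set is finite and nonempty) *)
Definition rhoD (R : realType) n (e : rel 'I_n) : R :=
  sup [set x : R | eigenvalue (distmx R e) x].

Definition has_even_factor n (e : rel 'I_n) : Prop :=
  exists F : rel 'I_n, symmetric F /\ (forall x y, F x y -> e x y) /\
    (forall v, 0 < deg F v /\ ~~ odd (deg F v)).

Definition graph_iso n (e1 e2 : rel 'I_n) : Prop :=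
  exists f : {perm 'I_n}, forall x y, e1 x y = e2 (f x) (f y).

(* K_d \/ (K_{n-2d+1} \cup (d-1)K_1) on 'I_n:
   vertices i < d form K_d, vertices d <= i < n-d+1 form K_{n-2d+1},
   vertices i >= n-d+1 are the (d-1) isolated vertices before the join. *)
Definition extremal_graph n (d : nat) : rel 'I_n :=
  fun i j => (i != j) &&
    [|| (i < d)%N, (j < d)%N | (i < n - d + 1)%N && (j < n - d + 1)%N].
Arguments extremal_graph : clear implicits.

(* Main.v *)
Require Import Defs.
From HB Require Import structures.
From mathcomp Require Import all_boot all_order all_algebra all_fingroup.
From mathcomp Require Import boolp classical_sets reals.
From mathcomp Require Import zify ring lra.
From mathcomp Require complex spectral.
Set Implicit Arguments. Unset Strict Implicit. Unset Printing Implicit Defensive.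
Import Order.TTheory GRing.Theory Num.Theory.

(* In fact G is hamiltonian.  Otherwise Posa's theorem provides i < n/2 and a set T
   of i vertices of degree at most i, so d <= i <= n/2 - 1.  The Rayleigh quotient
   of D(G) at the vector equal to a on T and to 1 elsewhere is then at least
   ((n - i + a i)^2 + a^2 i (i - 1) + 2 a i (n - 2 i)) / (n - i + a^2 i) - 1.
   That it exceeds mu - 1 is a condition concave in i, so it suffices to check
   i = d and i = n/2 - 1, with a = 2n / (n + 2d).  On the other hand a positive
   vector w with D w <= (mu - 1) w bounds the distance spectral radius of the
   extremal graph by mu - 1. *)

(** * Hamiltonian cycles and Posa's degree condition *)

Section Hamiltonian.
Variable T : finType.
Implicit Types (e : rel T) (p s : seq T).

Definition hamiltonian e := exists p, [/\ uniq p, size p = #|T| & path.cycle e p].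

Definition nbh e v : {set T} := [set u | e v u].

Definition add_edge e (x y : T) : rel T :=
  fun a b => [|| e a b, (a == x) && (b == y) | (a == y) && (b == x)].

Lemma hamiltonian_complete e :
  1 < #|T| -> (forall x y, x != y -> e x y) -> hamiltonian e.
Proof.
move=> T1 eT; exists (enum T); rewrite enum_uniq -cardE; split=> //.
move: (enum_uniq T) T1; rewrite cardE; case: (enum T) => [|x s] //= /andP[xs us] s0.
rewrite rcons_path; apply/andP; split; last first.
  apply: eT; apply: contraNneq xs => <-.
  by case: s s0 {us} => //= a s _; exact: mem_last.
elim: s x {s0} xs us => //= a s IH x; rewrite inE negb_or => /andP[xa _] /andP[as_ us].
by rewrite eT //= IH.
Qed.

(* The cycle u .. w v .. x obtained by reversing the tail of the path after w. *)
Lemma hamiltonian_path_crossing e u s x :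
  symmetric e -> uniq (u :: s) -> size (u :: s) = #|T| -> path e u s ->
  x \in s -> e u x -> e (last u s) (nth u (u :: s) (index x s)) -> hamiltonian e.
Proof.
move=> sym + + + xs; case/splitPr: xs => s1 s2 us szs.
rewrite cat_path /= => /and3P[ps1 ewx ps2] eux; rewrite last_cat /=.
have xs1 : x \notin s1.
  by move: us; rewrite /= cat_uniq /= => /and5P[_ _ /norP[]].
rewrite index_cat (negbTE xs1) /= eqxx addn0.
rewrite -cat_cons nth_cat /= ltnS leqnn nth_last /= => evw.
exists (u :: s1 ++ rev (x :: s2)); split.
- by rewrite -cat_cons cat_uniq rev_uniq has_rev -cat_uniq cat_cons.
- by rewrite -szs /= !size_cat size_rev.
rewrite /= rcons_path cat_path ps1 last_cat /=.
rewrite lastI rev_rcons /= sym evw /= rev_path.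
rewrite (eq_path (e' := e)) ?ps2 /=; last by move=> a b; exact: sym.
by case: s2 {us szs ps2 evw} => [|y s2] /=; rewrite ?rev_cons ?last_rcons sym.
Qed.

(** A hamiltonian cycle of the enlarged graph must traverse the new edge, since [e] has no such
    cycle; cutting it there leaves a hamiltonian path of [e] between [x] and [y]. *)
Lemma hamiltonian_add_edge e x y :
  2 < #|T| -> ~ hamiltonian e -> hamiltonian (add_edge e x y) ->
  exists u s, [/\ uniq (u :: s), size (u :: s) = #|T|, path e u s &
    (u, last u s) = (x, y) \/ (u, last u s) = (y, x)].
Proof.
move=> T2 nh [p [up sp cp]].
have /allPn[a ap nea] : ~~ all (fun a => e a (next p a)) p.
  apply/negP => /allP h; apply: nh; exists p; split=> //.
  by apply: cycle_from_next.
have := next_cycle cp ap; rewrite /add_edge (negbTE nea) /= => axy.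
have [i s ers] : rot_to_spec p (next p a) by apply: rot_to; rewrite mem_next.
set u := next p a in ers.
have us : uniq (u :: s) by rewrite -ers rot_uniq.
have ss : size (u :: s) = #|T| by rewrite -ers size_rot.
have la : last u s = a.
  have : next (u :: s) a = u by rewrite -ers next_rot.
  have := prev_next us a => + nu; rewrite nu => <-.
  rewrite prev_nth mem_head.
  have -> : index u s = size s by apply: memNindex; case/andP: us.
  by rewrite nth_last.
exists u, s; split=> //; last first.
  case/orP: axy => /andP[/eqP ax /eqP uy]; [right|left]; congr (_, _) => //; rewrite la; by [].
have ps : path (add_edge e x y) u s.
  by move: cp; rewrite -(rot_cycle i) ers /= rcons_path => /andP[].
(* No step of the path uses the new edge again: [a] occurs only at the end and [u] only at the
   start, so such a step would be the whole path, which [2 < #|T|] excludes. *)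
apply/(pathP u) => j js; have := pathP u ps j js.
have nz k : k < (size s).+1 -> nth u (u :: s) k = u -> k = 0.
  by move=> ks h; apply/eqP; rewrite -(@nth_uniq _ u (u :: s) k 0) // h.
have nl k : k < (size s).+1 -> nth u (u :: s) k = a -> k = size s.
  move=> ks h; apply/eqP; rewrite -(@nth_uniq _ u (u :: s) k (size s)) //= h.
  by rewrite -la -[last u s](nth_last u (u :: s)).
rewrite -[nth u s j]/(nth u (u :: s) j.+1).
move: (nz j (ltnW js)) (nl j (ltnW js)) (nl j.+1 js) T2; rewrite -ss [size (_ :: _)]/=.
rewrite -/u in axy; clear ers; clearbody u.
case/orP: axy => /andP[/eqP ? /eqP ?]; subst x y => nzj nlj nlj1 s1.
all: case/or3P => // /andP[/eqP h1 /eqP h2]; exfalso.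
all: first [by have := nlj h1; lia | move: (nlj1 h2) s1; rewrite (nzj h1) => <-].
all: by [].
Qed.

(* Posa's degree condition, read off an edge-maximal non-hamiltonian supergraph:
   among its non-edges xy take one of maximal degree sum; then each vertex that
   precedes a neighbour of x on a hamiltonian path from x to y is a non-neighbour
   of y, hence has degree at most that of x. *)
Lemma posa_obstruction e d :
  symmetric e -> irreflexive e -> 2 < #|T| -> ~ hamiltonian e ->
  (forall v, d <= #|nbh e v|) ->
  exists A : {set T}, [/\ d <= #|A|, #|A|.*2 < #|T| &
    forall v, v \in A -> #|nbh e v| <= #|A|].
Proof.
move=> + + T2.
(* Induction on the number of non-adjacent ordered pairs. Adding an edge only raises degrees, so a
   set [A] found for a larger non-hamiltonian graph also serves for [e]. *)
have [k] := ubnP #|[set xy | ~~ e xy.1 xy.2]|; elim: k e => // k IH e.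
rewrite ltnS => ek sym irr nh de.
have add_sym x y : symmetric (add_edge e x y).
  by move=> a b; rewrite /add_edge sym; lia.
have [[x [y [xy nexy nhxy]]]|noadd] := pselect (exists x y,
    [/\ x != y, ~~ e x y & ~ hamiltonian (add_edge e x y)]).
  have sub a b : e a b -> add_edge e x y a b by rewrite /add_edge => ->.
  have subn v : #|nbh e v| <= #|nbh (add_edge e x y) v|.
    by apply: subset_leq_card; apply/fintype.subsetP => w; rewrite !inE; exact: sub.
  have [|||||A [dA A2 hA]] := IH (add_edge e x y).
  - apply: leq_trans ek; apply: proper_card; apply/properP; split.
      by apply/fintype.subsetP => -[a b]; rewrite !inE; apply: contra; exact: sub.
    by exists (x, y); rewrite !inE //= /add_edge !eqxx orbT.
  - exact: add_sym.
  - move=> a; rewrite /add_edge irr /=; apply/negP.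
    by case/orP => /andP[/eqP h1 /eqP h2]; move: xy; rewrite -h1 -h2 eqxx.
  - exact: nhxy.
  - by move=> v; exact: leq_trans (de v) (subn v).
  by exists A; split=> // v vA; exact: leq_trans (subn v) (hA v vA).
have max a b : a != b -> ~~ e a b -> hamiltonian (add_edge e a b).
  by move=> ab eab; apply: contrapT => h; apply: noadd; exists a, b.
pose P (xy : T * T) := (xy.1 != xy.2) && ~~ e xy.1 xy.2.
have [[x0 y0] P0] : exists xy, P xy.
  apply: contrapT => nP; apply: nh; apply: hamiltonian_complete; first exact: ltnW.
  by move=> x y xy; apply: contrapT => /negP exy; apply: nP; exists (x, y); apply/andP.
pose f (xy : T * T) := #|nbh e xy.1| + #|nbh e xy.2|.
have := @arg_maxnP _ (x0, y0) P f P0.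
case=> -[x y] /andP[/= xy nexy] fmax.
have key u v : (u, v) = (x, y) \/ (u, v) = (y, x) ->
    forall w, w != v -> ~~ e w v -> #|nbh e w| <= #|nbh e u|.
  move=> uv w wv ewv; rewrite -(leq_add2r #|nbh e v|).
  have /= := fmax (w, v); rewrite /P /f /= wv ewv => /(_ isT).
  by case: uv => -[-> ->] //; rewrite [X in _ <= X]addnC.
(* The path is reversed if necessary, so that it starts at an end whose degree is at most that of
   the other end. *)
have [u [s [us szs ps hu leuv]]] : exists u s, [/\ uniq (u :: s),
    size (u :: s) = #|T|, path e u s,
    forall w, w != last u s -> ~~ e w (last u s) -> #|nbh e w| <= #|nbh e u| &
    #|nbh e u| <= #|nbh e (last u s)|].
  have [u [s [us szs ps ends]]] := hamiltonian_add_edge T2 nh (max x y xy nexy).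
  have [le|/ltnW le] := leqP #|nbh e u| #|nbh e (last u s)|.
    by exists u, s; split=> //; exact: key.
  have E : rev (u :: s) = last u s :: rev (belast u s) by rewrite lastI rev_rcons.
  have l : last (last u s) (rev (belast u s)) = u.
    by case: s {us szs ps ends le E} => //= z s; rewrite rev_cons last_rcons.
  exists (last u s), (rev (belast u s)); rewrite l -E rev_uniq size_rev; split=> //.
    by rewrite rev_path (eq_path (e' := e)) // => a b; exact: sym.
  by apply: key; case: ends => -[-> ->]; [right|left].
(* The index is taken in the tail [s] but read in [u :: s], so [g w] is the predecessor of [w] on
   the path. *)
pose v := last u s; pose g w := nth u (u :: s) (index w s).
have nbs w : w \in nbh e u -> w \in s.
  rewrite inE => euw; have : w \in u :: s.
    have sT : {subset u :: s <= enum T} by move=> z; rewrite mem_enum.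
    by have [|_ ->] := uniq_min_size us sT; rewrite ?mem_enum // -cardE szs.
  by rewrite inE => /predU1P[wu|//]; rewrite wu irr in euw.
have g_inj : {in nbh e u &, injective g}.
  move=> a b /nbs as_ /nbs bs /eqP; rewrite nth_uniq // ?ltnS ?index_size //.
  by move=> /eqP ab; rewrite -(nth_index u as_) ab nth_index.
have gv w : w \in nbh e u -> ~~ e v (g w).
  move=> wu; apply/negP => evg; apply: nh.
  by apply: (hamiltonian_path_crossing sym us szs ps (nbs w wu)) => //; rewrite inE in wu.
have gnv w : w \in nbh e u -> g w != v.
  move=> /nbs ws; rewrite /g /v -[last u s](nth_last u (u :: s)) nth_uniq //=.
    by rewrite ltn_eqF // index_mem.
  by rewrite ltnS index_size.
exists (g @: nbh e u); rewrite card_in_imset //; split.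
- exact: de.
(* The predecessors avoid [v] and its neighbours, so the degrees of [u] and [v] sum to less than
   [#|T|], and that of [u] is not the larger one. *)
- have : g @: nbh e u \subset ~: (v |: nbh e v).
    apply/fintype.subsetP => _ /imsetP[w wu ->]; rewrite !inE negb_or gnv //=; exact: gv.
  move/subset_leq_card; rewrite card_in_imset // => h.
  have := cardsC (v |: nbh e v); rewrite cardsU1 inE irr /= -/v in leuv *; lia.
- move=> _ /imsetP[w wu ->]; apply: hu; first exact: gnv.
  by rewrite sym gv.
Qed.
End Hamiltonian.

(** The cycle itself is a 2-regular factor; [2 < n] guarantees that the successor and the
    predecessor of a vertex differ. *)
Lemma hamiltonian_even_factor n (e : rel 'I_n) :
  2 < n -> symmetric e -> hamiltonian e -> has_even_factor e.
Proof.
move=> n2 sym [p [up sp cp]]; rewrite card_ord in sp.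
exists (fun x y => (next p x == y) || (next p y == x)); split.
  by move=> x y; rewrite orbC.
have mp v : v \in p.
  have sT : {subset p <= enum 'I_n} by move=> z; rewrite mem_enum.
  by have [|_ ->] := uniq_min_size up sT; rewrite ?mem_enum // size_enum_ord sp.
split=> [x y|v].
  by case/orP => /eqP <-; [|rewrite sym]; exact: next_cycle.
suff -> : deg (fun x y => (next p x == y) || (next p y == x)) v = 2 by [].
have -> : deg (fun x y => (next p x == y) || (next p y == x)) v =
    #|[set next p v; prev p v]|.
  apply: eq_card => u; rewrite !inE eq_sym; congr (_ || _).
  by apply/eqP/eqP => [<-|->]; rewrite ?prev_next ?next_prev.
rewrite cards2; suff -> : next p v != prev p v by [].
apply/eqP => npv; have nnv : next p (next p v) = v by rewrite npv next_prev.
have [i s ers] := rot_to (mp v).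
have us : uniq (v :: s) by rewrite -ers rot_uniq.
have ss : size (v :: s) = n by rewrite -ers size_rot.
have nE x : next p x = next (v :: s) x by rewrite -ers next_rot.
case: s us ss nE {ers} => [|a [|b s]] us ss nE; rewrite /= in ss; try lia.
move: nnv us; rewrite !nE /= !eqxx /=; case: eqP => [->|_]; first by rewrite inE eqxx.
by move=> ->; rewrite !inE eqxx !orbT.
Qed.

(** * Graph distance through bounded walks *)

Lemma mem_ballP n (e : rel 'I_n) k x y :
  reflect (exists p, [/\ path e x p, size p <= k & last x p = y]) (y \in ball e k x).
Proof.
elim: k y => [|k IH] y /=.
  rewrite inE; apply: (iffP eqP) => [->|[p [_ + <-]]]; first by exists [::].
  by rewrite leqn0 size_eq0 => /eqP ->.
rewrite !inE; apply: (iffP orP) => [[/IH[p [pp sp lp]]|/bigcupP[z /IH[p [pp sp lp]]]]|[p]].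
- by exists p; split=> //; exact: leqW.
- by rewrite inE => ezy; exists (rcons p y); rewrite rcons_path size_rcons last_rcons pp lp.
case: (lastP p) => [[_ _ <-]|q z]; first by left; apply/IH; exists [::].
rewrite rcons_path size_rcons last_rcons => -[/andP[pq ez] sq <-].
by right; apply/bigcupP; exists (last x q); [apply/IH; exists q|rewrite inE].
Qed.

Lemma ball_sym n (e : rel 'I_n) k x y :
  symmetric e -> (y \in ball e k x) = (x \in ball e k y).
Proof.
move=> sym; have half a b : b \in ball e k a -> a \in ball e k b.
  move=> /mem_ballP[p [pp sp <-]]; apply/mem_ballP; exists (rev (belast a p)).
  rewrite size_rev size_belast rev_path (eq_path (e' := e)) //.
  by split=> //; case: p {pp sp} => //= c p; rewrite rev_cons last_rcons.
by apply/idP/idP; exact: half.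
Qed.

Lemma dist_sym n (e : rel 'I_n) x y : symmetric e -> dist e x y = dist e y x.
Proof. by move=> sym; apply: eq_find => k; exact: ball_sym. Qed.

(** The bound [k <= n] covers the default case: [find] returns [n] when no ball of radius below [n]
    contains [y]. *)
Lemma dist_lb n (e : rel 'I_n) k x y :
  k <= n -> (forall j, j < k -> y \notin ball e j x) -> k <= dist e x y.
Proof.
move=> kn h; rewrite leqNgt; apply/negP => lt.
have has_b : has (fun j => y \in ball e j x) (iota 0 n).
  by rewrite has_find size_iota (leq_trans lt).
have := nth_find 0 has_b; rewrite -/(dist e x y) nth_iota ?(leq_trans lt) //.
by rewrite (negbTE (h _ lt)).
Qed.

Lemma dist_ub n (e : rel 'I_n) k x y : k < n -> y \in ball e k x -> dist e x y <= k.
Proof.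
move=> kn h; rewrite leqNgt; apply/negP => /(before_find 0).
by rewrite nth_iota // add0n h.
Qed.

Lemma dist_le n (e : rel 'I_n) x y : dist e x y <= n.
Proof. by rewrite -{2}[n](size_iota 0) find_size. Qed.

Lemma distxx n (e : rel 'I_n) x : dist e x x = 0.
Proof.
apply/eqP; rewrite -leqn0; apply: dist_ub; last by rewrite inE.
exact: leq_ltn_trans (leq0n x) (ltn_ord x).
Qed.

Lemma dist_nonadj n (e : rel 'I_n) x y :
  1 < n -> x != y -> 1 + ~~ e x y <= dist e x y.
Proof.
move=> n1 xy; apply: dist_lb => [|[|[|j]] jk]; first by case: (e x y) n1 => // /ltnW.
- by rewrite inE eq_sym.
- move: jk; case exy: (e x y) => // _; rewrite /= !inE eq_sym (negbTE xy) /=.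
  by apply/bigcupP => -[z]; rewrite !inE => /eqP ->; rewrite exy.
- by case: (e x y) jk.
Qed.

Lemma dist_adj n (e : rel 'I_n) x y : 1 < n -> e x y -> dist e x y <= 1.
Proof.
move=> n1 exy; apply: dist_ub => //.
by apply/mem_ballP; exists [:: y]; rewrite /= exy.
Qed.

Lemma dist_le2 n (e : rel 'I_n) x y z : 2 < n -> e x z -> e z y -> dist e x y <= 2.
Proof.
move=> n2 exz ezy; apply: dist_ub => //.
by apply/mem_ballP; exists [:: z; y]; rewrite /= exz ezy.
Qed.

Local Open Scope ring_scope.

(** * Eigenvalue bounds for real matrices *)

Section Spectrum.
Import complex spectral sesquilinear.

(** Over the complex numbers [A] becomes hermitian and is unitarily diagonalised with real
    eigenvalues. In these coordinates the quadratic form is the sum of the eigenvalues weighted by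
    squared moduli, and the largest eigenvalue bounds it. *)
Lemma rayleigh_le_eigenvalue (R : rcfType) n (A : 'M[R]_n) (x : 'rV[R]_n) :
  (0 < n)%N -> A^T = A ->
  exists2 a, eigenvalue A a & (x *m A *m x^T) 0 0 <= a * (x *m x^T) 0 0.
Proof.
move=> n0 sA; pose toC : {rmorphism R -> complex R} := real_complex R.
pose B := map_mx toC A; pose X := map_mx toC x.
have realM m p (M : 'M[R]_(m, p)) : map_mx toC M \is a mxOver Num.real.
  by apply/mxOverP => i j; rewrite mxE; apply/complex_realP; exists (M i j).
have hB : B \is hermitianmx _ false Num.conj.
  apply: realsym_hermsym; last exact: realM.
  by apply/is_hermitianmxP; rewrite expr0 scale1r; apply/matrixP => i j; rewrite !mxE -{1}sA mxE.
pose P := spectralmx B; pose sp := spectral_diag B.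
have uP : P \is unitarymx := spectral_unitarymx B.
have EB : B = invmx P *m diag_mx sp *m P.
  by apply/orthomx_spectralP; exact: hermitian_normalmx.
have /mxOverP rsp := hermitian_spectral_diag_real hB.
pose l k := complex.Re (sp 0 k).
have lE k : toC (l k) = sp 0 k by rewrite /toC /= RRe_real //; exact: rsp.
(* The rows of [P] are left eigenvectors, the kind that [eigenvalue] refers to. *)
have l_eig k : eigenvalue A (l k).
  rewrite -(eigenvalue_map toC) lE; apply/eigenvalueP; exists (row k P).
    rewrite -/B -row_mul EB !mulmxA mulmxV ?mul1mx ?spectral_unit //.
    by rewrite mul_diag_mx; apply/rowP => h; rewrite !mxE.
  apply/eqP => /(congr1 (mulmx^~ (invmx P))).
  rewrite -row_mul mulmxV ?spectral_unit // mul0mx => /rowP/(_ k)/eqP.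
  by rewrite !mxE eqxx oner_eq0.
pose k0 := Ordinal n0.
have [k _ kmax] := @Order.TotalTheory.arg_maxP _ _ _ k0 xpredT l isT.
exists (l k) => //.
pose w := X *m invmx P.
pose q h := (`|w 0 h| ^+ 2).
have wE h : (P *m X^T) h 0 = (w 0 h)^*.
  have -> : P *m X^T = map_mx Num.conj w^T.
    apply/matrixP => i j; rewrite /w invmx_unitary // !mxE rmorph_sum.
    apply: eq_bigr => g _; rewrite !mxE rmorphM /= conjCK mulrC; congr (_ * _).
    by apply/esym/CrealP/complex_realP; exists (x j g).
  by rewrite !mxE.
have E1 : toC ((x *m A *m x^T) 0 0) = \sum_h sp 0 h * q h.
  have -> : toC ((x *m A *m x^T) 0 0) = (X *m B *m X^T) 0 0.
    by rewrite /X /B map_trmx -!map_mxM [RHS]mxE.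
  rewrite EB !mulmxA -/w -mulmxA mxE; apply: eq_bigr => h _.
  by rewrite wE mul_mx_diag mxE /q normCK mulrA [w 0 h * _]mulrC.
have E2 : toC ((x *m x^T) 0 0) = \sum_k q k.
  have -> : toC ((x *m x^T) 0 0) = (X *m X^T) 0 0.
    by rewrite /X map_trmx -!map_mxM [RHS]mxE.
  rewrite -[X in X *m _](mulmxKV (spectral_unit B)) -/w -/P -mulmxA mxE.
  by apply: eq_bigr => k' _; rewrite wE /q normCK.
have lecC (b c : R) : toC b <= toC c -> b <= c by rewrite /toC /= lecR.
apply: lecC; rewrite E1 rmorphM E2 mulr_sumr ler_sum // => i _.
rewrite -lE ler_wpM2r //; first by rewrite exprn_ge0.
by rewrite /toC /= lecR; exact: kmax.
Qed.
End Spectrum.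

(** A Collatz-Wielandt bound: the eigenvector equation is read at the index where the ratio of the
    eigenvector's modulus to [y] is largest. *)
Lemma eigenvalue_le_weighted (R : realFieldType) n (A : 'M[R]_n) (y : 'I_n -> R) l a :
  (forall i j, 0 <= A i j) -> (forall i, 0 < y i) ->
  (forall j, \sum_i y i * A i j <= l * y j) -> eigenvalue A a -> a <= l.
Proof.
move=> A0 y0 hl /eigenvalueP[v vA /rV0Pn[i0 vi0]].
have [j _ jmax] := @Order.TotalTheory.arg_maxP _ _ _ i0 xpredT (fun i => `|v 0 i| / y i) isT.
set m := `|v 0 j| / y j in jmax.
have m0 : 0 < m.
  by apply: lt_le_trans (jmax i0 isT); rewrite divr_gt0 ?normr_gt0.
have vj : `|v 0 j| = m * y j by rewrite divfK ?gt_eqF.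
have le : `|a| * `|v 0 j| <= m * \sum_i y i * A i j.
  rewrite -normrM; have /rowP/(_ j) := vA; rewrite !mxE => <-.
  apply: le_trans (ler_norm_sum _ _ _) _; rewrite mulr_sumr ler_sum // => i _.
  rewrite normrM (ger0_norm (A0 _ _)) mulrA ler_wpM2r //.
  by have /= := jmax i isT; rewrite ler_pdivrMr.
apply: le_trans (ler_norm a) _.
rewrite -(ler_pM2r (mulr_gt0 m0 (y0 j))) -{1}vj; apply: le_trans le _.
by rewrite mulrCA ler_pM2l.
Qed.

(** * A rational threshold separating the two spectral radii *)

(* mu := mu_num / mu_den = n + 3t + 1/2 - (48t^2 + 32t) / (4n + 19t), with t = d - 1,
   is a rational upper bound for rhoD + 1 of the extremal graph; its leading terms
   come from the expansion of the root of the cubic, the others were fitted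
   numerically so as to leave room on both sides. *)
Definition mu_den (R : realFieldType) (n t : R) : R := 2 * (4 * n + 19 * t).

Definition mu_num (R : realFieldType) (n t : R) : R :=
  2 * ((n + 3 * t) * (4 * n + 19 * t) - 48 * t ^+ 2 - 32 * t) + (4 * n + 19 * t).

(* In this lemma and the next, after n = m + 8s + 10 and t = s + 1 only a few
   coefficients in m, s >= 0 have the wrong sign; multiples of
   [c0], which is the quadratic hypothesis, absorb them. *)
Lemma cubic_num_ge0 (R : realFieldType) (n t : R) (X := mu_den n t) (N := mu_num n t) :
  1 <= t -> 8 * t + 2 <= n -> (t + 1) ^+ 2 + 9 <= 3 * n ->
  0 <= N * (N + X) * (N - X * (n - t))
       - X * t * (N + X * (n - 2 * t - 1)) * (2 * N - X * (t + 1)).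
Proof.
move=> t_ge1 n_ge n_ge_sqr.
pose s := t - 1; pose m := n - 8 * t - 2.
have s0 : 0 <= s by rewrite /s; lra.
have m0 : 0 <= m by rewrite /m; lra.
have tE : t = s + 1 by rewrite /s; ring.
have nE : n = m + 8 * s + 10 by rewrite /m /s; ring.
have c0 : 0 <= 17 + 20 * s + 3 * m - s ^+ 2 by move: n_ge_sqr; rewrite nE tE; lra.
have mono k l : 0 <= m ^+ k * s ^+ l by rewrite mulr_ge0 ?exprn_ge0.
have := mulr_ge0 (mono 2 2) c0; have := mulr_ge0 (mono 3 1) c0.
have := mulr_ge0 (mono 1 3) c0.
rewrite /N /X /mu_num /mu_den nE tE; clearbody s m; clear N X n_ge_sqr n_ge t_ge1 c0 nE tE n t.
have := mono 0 1; have := mono 0 2; have := mono 0 3; have := mono 0 4;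
have := mono 0 5; have := mono 0 6.
have := mono 1 0; have := mono 1 1; have := mono 1 2; have := mono 1 3; have := mono 1 4.
have := mono 2 0; have := mono 2 1; have := mono 2 2; have := mono 2 3.
have := mono 3 0; have := mono 3 1; have := mono 3 2.
have := mono 4 0; have := mono 4 1; have := mono 5 0.
clear mono s0 m0; rewrite ?expr0 ?mul1r ?mulr1.
lra.
Qed.


Lemma rayleigh_num_gt0 (R : realFieldType) (n t : R) (X := mu_den n t)
    (N := mu_num n t) (A := 2 * n) (B := n + 2 * (t + 1)) (i := t + 1) :
  1 <= t -> 8 * t + 2 <= n -> (t + 1) ^+ 2 + 9 <= 3 * n ->
  0 < X * (((n - i) * B + A * i) ^+ 2 + A ^+ 2 * i * (i - 1) + 2 * A * B * i * (n - 2 * i))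
      - N * ((n - i) * B ^+ 2 + A ^+ 2 * i).
Proof.
move=> t_ge1 n_ge n_ge_sqr.
pose s := t - 1; pose m := n - 8 * t - 2.
have s0 : 0 <= s by rewrite /s; lra.
have m0 : 0 <= m by rewrite /m; lra.
have tE : t = s + 1 by rewrite /s; ring.
have nE : n = m + 8 * s + 10 by rewrite /m /s; ring.
have c0 : 0 <= 17 + 20 * s + 3 * m - s ^+ 2 by move: n_ge_sqr; rewrite nE tE; lra.
have mono k l : 0 <= m ^+ k * s ^+ l by rewrite mulr_ge0 ?exprn_ge0.
have := mulr_ge0 (mono 0 2) c0; have := mulr_ge0 (mono 0 3) c0.
have := mulr_ge0 (mono 1 2) c0.
rewrite /i /A /B /N /X /mu_num /mu_den nE tE.
clearbody s m; clear i A B N X n_ge_sqr n_ge t_ge1 c0 nE tE n t.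
have := mono 0 1; have := mono 0 2; have := mono 0 3; have := mono 0 4; have := mono 0 5.
have := mono 1 0; have := mono 1 1; have := mono 1 2; have := mono 1 3; have := mono 1 4.
have := mono 2 0; have := mono 2 1; have := mono 2 2; have := mono 2 3.
have := mono 3 0; have := mono 3 1; have := mono 4 0.
clear mono s0 m0; rewrite ?expr0 ?mul1r ?mulr1.
lra.
Qed.

(** The other end of the range of [i], with the denominators of [mu = N / X] and [a = A / B]
    cleared. After the same substitution nonnegative monomials in [m] and [s] suffice. *)
Lemma rayleigh_half_num_gt0 (R : realFieldType) (n t : R) (X := mu_den n t)
    (N := mu_num n t) (A := 2 * n) (B := n + 2 * (t + 1)) (i := n / 2 - 1) :
  1 <= t -> 8 * t + 2 <= n ->
  0 < X * (((n - i) * B + A * i) ^+ 2 + A ^+ 2 * i * (i - 1) + 2 * A * B * i * (n - 2 * i))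
      - N * ((n - i) * B ^+ 2 + A ^+ 2 * i).
Proof.
move=> t_ge1 n_ge.
pose s := t - 1; pose m := n - 8 * t - 2.
have s0 : 0 <= s by rewrite /s; lra.
have m0 : 0 <= m by rewrite /m; lra.
have tE : t = s + 1 by rewrite /s; ring.
have nE : n = m + 8 * s + 10 by rewrite /m /s; ring.
have mono k l : 0 <= m ^+ k * s ^+ l by rewrite mulr_ge0 ?exprn_ge0.
rewrite /i /A /B /N /X /mu_num /mu_den nE tE.
clearbody s m; clear i A B N X n_ge t_ge1 nE tE n t.
have := mono 0 1; have := mono 0 2; have := mono 0 3; have := mono 0 4; have := mono 0 5.
have := mono 1 0; have := mono 1 1; have := mono 1 2; have := mono 1 3; have := mono 1 4.
have := mono 2 0; have := mono 2 1; have := mono 2 2; have := mono 2 3.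
have := mono 3 0; have := mono 3 1; have := mono 3 2; have := mono 4 0.
have := mono 4 1; have := mono 5 0.
clear mono s0 m0; rewrite ?expr0 ?mul1r ?mulr1.
lra.
Qed.

(** The cubic inequality serves to bound the extremal graph by [mu - 1] from above; the last
    condition puts the Rayleigh quotient of a graph with a low-degree set of size [i] strictly above
    [mu - 1]. *)
Lemma spectral_window (R : realFieldType) (n t : R) :
  1 <= t -> 8 * t + 2 <= n -> (t + 1) ^+ 2 + 9 <= 3 * n ->
  exists mu a : R, [/\ n <= mu,
    t * (mu + n - 2 * t - 1) * (2 * mu - t - 1) <= mu * (mu + 1) * (mu - n + t),
    0 <= a <= 2 &
    forall i, t + 1 <= i <= n / 2 - 1 ->
      mu * (n - i + a ^+ 2 * i) <
      (n - i + a * i) ^+ 2 + a ^+ 2 * i * (i - 1) + 2 * a * i * (n - 2 * i)].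
Proof.
move=> t1 n8 nsqr.
pose X := mu_den n t; pose N := mu_num n t; pose A := 2 * n; pose B := n + 2 * (t + 1).
have X0 : 0 < X by rewrite /X /mu_den; lra.
have B0 : 0 < B by rewrite /B; lra.
have hP := cubic_num_ge0 t1 n8 nsqr.
have hd := rayleigh_num_gt0 t1 n8 nsqr.
have hh := rayleigh_half_num_gt0 t1 n8.
rewrite -/X -/N -/A -/B in hP hd hh.
exists (N / X), (A / B); split.
- rewrite ler_pdivlMr // /N /X /mu_num /mu_den.
  have : 0 <= (n - 8 * t - 2) * t by apply: mulr_ge0; lra.
  have : 0 <= (t - 1) * t by apply: mulr_ge0; lra.
  lra.
- rewrite -subr_ge0; set L := (X in 0 <= X).
  have -> : L = (N * (N + X) * (N - X * (n - t))
       - X * t * (N + X * (n - 2 * t - 1)) * (2 * N - X * (t + 1))) / X ^+ 3.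
    by rewrite /L; field; exact: lt0r_neq0.
  by rewrite divr_ge0 // exprn_ge0 // ltW.
- apply/andP; split; last by rewrite ler_pdivrMr // /A /B; lra.
  by apply: divr_ge0; [rewrite /A; lra|exact: ltW].
move=> i /andP[i1 i2].
have XB : 0 < X * B ^+ 2 by rewrite mulr_gt0 // exprn_gt0.
rewrite -subr_gt0 -(pmulr_rgt0 _ XB).
pose g (i : R) :=
  X * (((n - i) * B + A * i) ^+ 2 + A ^+ 2 * i * (i - 1) + 2 * A * B * i * (n - 2 * i))
      - N * ((n - i) * B ^+ 2 + A ^+ 2 * i).
set L := (X in 0 < X).
have -> : L = g i by rewrite /L /g; field; rewrite !lt0r_neq0.
have {}hd : 0 < g (t + 1) by exact: hd.
have {}hh : 0 < g (n / 2 - 1) by exact: hh.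
have pq : 0 < n / 2 - 1 - (t + 1) by lra.
rewrite -(pmulr_rgt0 _ pq).
(* Since [g] is quadratic in [i], it equals its chord plus a correction governed by the leading
   coefficient [- X * (6 * A * B - 2 * A ^+ 2 - B ^+ 2)]; [q0] below is concavity. *)
have -> : (n / 2 - 1 - (t + 1)) * g i = (n / 2 - 1 - i) * g (t + 1) + (i - (t + 1)) * g (n / 2 - 1)
  + (n / 2 - 1 - (t + 1)) * (i - (t + 1)) * (n / 2 - 1 - i) * X * (6 * A * B - 2 * A ^+ 2 - B ^+ 2).
  by rewrite /g; field.
have q0 : 0 <= 6 * A * B - 2 * A ^+ 2 - B ^+ 2.
  have -> : 6 * A * B - 2 * A ^+ 2 - B ^+ 2 =
      4 * (A * (B - n)) + B * (3 * n - 2 * (t + 1)) by rewrite /A /B; ring.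
  have A0 : 0 <= A by rewrite /A; lra.
  have Bn : 0 <= B - n by rewrite /B; lra.
  have hB : 0 <= B * (3 * n - 2 * (t + 1)) by apply: mulr_ge0; [exact: ltW|lra].
  by have := mulr_ge0 A0 Bn; lra.
apply: ltr_wpDr.
  by do !apply: mulr_ge0; rewrite ?(ltW X0) //; lra.
have [->|ne] := eqVneq i (t + 1).
  by rewrite subrr mul0r addr0 mulr_gt0.
have ilt : t + 1 < i by rewrite lt_neqAle eq_sym ne.
apply: ltr_wpDl; first by apply: mulr_ge0; [lra|exact: ltW].
by apply: mulr_gt0 => //; lra.
Qed.

(** * Bounds for the distance spectral radius *)

(** The supremum is an upper bound only once the spectrum is bounded above; all entries being at
    most [n], constant weights give the bound [n * n]. *)
Lemma eigenvalue_le_rhoD (R : realType) n (e : rel 'I_n) (a : R) :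
  eigenvalue (distmx R e) a -> a <= rhoD R e.
Proof.
move=> ha; apply: ub_le_sup => //; exists (n%:R * n%:R) => b /= hb.
apply: (eigenvalue_le_weighted (y := fun=> 1) _ _ _ hb) => [i j|//|j].
  by rewrite mxE ler0n.
apply: (@le_trans _ _ (\sum_(i < n) (n%:R : R))); last first.
  by rewrite /= sumr_const card_ord mulr1 -[leLHS]mulr_natl.
by rewrite ler_sum // => i _; rewrite mxE mul1r ler_nat; exact: dist_le.
Qed.

Lemma rhoD_le (R : realType) n (e : rel 'I_n) (y : 'I_n -> R) l :
  0 <= l -> (forall i, 0 < y i) ->
  (forall j, \sum_i y i * (dist e i j)%:R <= l * y j) -> rhoD R e <= l.
Proof.
move=> l0 y0 hl; rewrite /rhoD.
(* The supremum of the empty set is 0 by convention, hence the hypothesis [0 <= l]. *)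
have [->|ne] := eqVneq [set x : R | eigenvalue (distmx R e) x]%classic set0.
  by rewrite sup0.
apply: ge_sup; first by apply/set0P.
move=> a /= ha; apply: (eigenvalue_le_weighted (y := y) _ y0 _ ha) => [i j|j].
  by rewrite mxE ler0n.
by under eq_bigr do rewrite mxE; exact: hl.
Qed.

Lemma rhoD_ge_rayleigh (R : realType) n (e : rel 'I_n) (x : 'I_n -> R) l :
  (0 < n)%N -> symmetric e -> (exists i, x i != 0) ->
  l * \sum_i x i ^+ 2 < \sum_i \sum_j x i * x j * (dist e i j)%:R -> l < rhoD R e.
Proof.
move=> n0 sym [i0 xi0] hl; pose X : 'rV[R]_n := \row_i x i.
have sD : (distmx R e)^T = distmx R e.
  by apply/matrixP => i j; rewrite !mxE dist_sym.
have [a ha le] := rayleigh_le_eigenvalue X n0 sD.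
apply: lt_le_trans (eigenvalue_le_rhoD ha).
have E1 : (X *m X^T) 0 0 = \sum_i x i ^+ 2.
  by rewrite mxE; apply: eq_bigr => i _; rewrite !mxE expr2.
have E2 : (X *m distmx R e *m X^T) 0 0 = \sum_i \sum_j x i * x j * (dist e i j)%:R.
  rewrite mxE exchange_big; apply: eq_bigr => j _ /=.
  rewrite !mxE mulr_suml; apply: eq_bigr => i _; rewrite !mxE; ring.
rewrite E1 E2 in le; move: (lt_le_trans hl le); rewrite ltr_pM2r //.
rewrite (bigD1 i0) //= ltr_pwDl ?exprn_even_gt0 //.
by apply: sumr_ge0 => i _; exact: sqr_ge0.
Qed.

(** * Rayleigh quotient at a set of low-degree vertices *)

Lemma sum_if_mem (R : realFieldType) n (T : {set 'I_n}) (p q : R) :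
  \sum_u (if u \in T then p else q) = #|T|%:R * p + (n%:R - #|T|%:R) * q.
Proof.
rewrite (bigID (fun u => u \in T)) /=; congr (_ + _).
  rewrite (eq_bigr (fun=> p)) => [|u ->] //.
  by rewrite sumr_const -[LHS]mulr_natl.
rewrite (eq_bigr (fun=> q)) => [|u /negbTE ->] //.
rewrite sumr_const -[LHS]mulr_natl; congr (_ * _).
by apply/eqP; rewrite eq_sym subr_eq addrC -natrD cardC card_ord.
Qed.

(* Let B be the adjacency matrix of the complement, which D dominates beyond J - I.
   Charged to the rows in T, an entry of B outside T x T is worth 2a in x B x^T
   (together with its transpose) and one inside T x T is worth a^2 <= 2a; each such
   row has at least n - 1 - #|T| entries, at most #|T| - 1 of them inside T x T. *)
Lemma low_degree_rayleigh (R : realType) n (e : rel 'I_n) (T : {set 'I_n}) (a : R)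
    (i := #|T|%:R : R) (N := n%:R : R) (x := fun v => if v \in T then a else 1) :
  (1 < n)%N -> symmetric e -> irreflexive e -> 0 <= a <= 2 ->
  (forall v, v \in T -> deg e v <= #|T|)%N ->
  (N - i + a * i) ^+ 2 - (N - i + a ^+ 2 * i) +
    (a ^+ 2 * i * (i - 1) + 2 * a * i * (N - 2 * i)) <=
  \sum_u \sum_v x u * x v * (dist e u v)%:R.
Proof.
move=> n1 sym irr /andP[a0 a2] hT.
pose b u v : R := ((u != v) && ~~ e u v)%:R.
have x0 u : 0 <= x u by rewrite /x; case: ifP.
have b0 u v : 0 <= b u v by exact: ler0n.
have sumT (p q : R) : \sum_u (if u \in T then p else q) = i * p + (N - i) * q.
  exact: sum_if_mem.
have Ex : \sum_u x u = N - i + a * i by rewrite sumT; ring.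
have Ex2 : \sum_u x u ^+ 2 = N - i + a ^+ 2 * i.
  rewrite -[RHS](_ : i * a ^+ 2 + (N - i) * 1 = _); last by ring.
  by rewrite -sumT; apply: eq_bigr => u _; rewrite /x; case: ifP => _; rewrite ?expr1n.
have Exx : \sum_u \sum_v x u * x v * (u != v)%:R =
    (N - i + a * i) ^+ 2 - (N - i + a ^+ 2 * i).
  rewrite -Ex -Ex2 expr2 mulr_suml -sumrB; apply: eq_bigr => u _.
  rewrite mulr_sumr [in RHS](bigD1 u) //= (bigD1 u) //= eqxx mulr0 add0r.
  rewrite -expr2 addrAC subrr add0r; apply: eq_bigr => v vu.
  by rewrite eq_sym vu mulr1.
have le1 : (N - i + a * i) ^+ 2 - (N - i + a ^+ 2 * i) + \sum_u \sum_v x u * x v * b u v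
    <= \sum_u \sum_v x u * x v * (dist e u v)%:R.
  rewrite -Exx -big_split; apply: ler_sum => u _; rewrite -big_split; apply: ler_sum => v _ /=.
  rewrite -mulrDr ler_wpM2l ?mulr_ge0 // /b -natrD ler_nat.
  have [->|uv] := eqVneq u v; first by [].
  exact: dist_nonadj.
apply: le_trans le1; rewrite lerD2l.
(* The weight is halved inside [T] because such a pair is charged from both of its rows; pairs
   outside [T] are dropped. *)
pose w u v : R := if u \in T then (if v \in T then a ^+ 2 / 2 else a) else 0.
have le2 : \sum_u \sum_v (w u v + w v u) * b u v <= \sum_u \sum_v x u * x v * b u v.
  apply: ler_sum => u _; apply: ler_sum => v _; apply: ler_wpM2r => //.
  by rewrite /w /x; case: (u \in T); case: (v \in T); lra.
apply: le_trans le2.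
have -> : \sum_u \sum_v (w u v + w v u) * b u v = \sum_u \sum_v 2 * w u v * b u v.
  under eq_bigr => u _ do (under eq_bigr => v _ do rewrite mulrDl; rewrite big_split).
  rewrite big_split /= [X in _ + X]exchange_big /= -big_split; apply: eq_bigr => u _ /=.
  rewrite -big_split; apply: eq_bigr => v _ /=.
  by rewrite /b eq_sym sym; ring.
pose r := a ^+ 2 * (i - 1) + 2 * a * (N - 2 * i).
have -> : a ^+ 2 * i * (i - 1) + 2 * a * i * (N - 2 * i) = \sum_u (if u \in T then r else 0).
  by rewrite sumT /r; ring.
apply: ler_sum => u _; case: ifP => uT; last first.
  by apply: sumr_ge0 => v _; rewrite /w uT mulr0 mul0r.
have sum_bool (P : pred 'I_n) : \sum_v (P v)%:R = #|P|%:R :> R.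
  rewrite -sum1_card natr_sum [RHS]big_mkcond /=.
  by apply: eq_bigr => v _; rewrite unfold_in; case: (P v).
have row_sum : N - 1 - i <= \sum_v b u v.
  rewrite sum_bool; set c := #|_|.
  have hc : (n <= c + (1 + #|T|))%N.
    have := cardsC (u |: [set v | e u v]); rewrite cardsU1 inE irr card_ord /=.
    have -> : #|~: (u |: [set v | e u v])| = c.
      by apply: eq_card => v; rewrite !inE negb_or eq_sym.
    by move=> cn; rewrite -[leqLHS]cn addnC leq_add2l leq_add2l; exact: hT.
  have : n%:R <= (c + (1 + #|T|))%:R :> R by rewrite ler_nat.
  rewrite !natrD /N /i; lra.
have row_sumT : \sum_v (if v \in T then b u v else 0) <= i - 1.
  rewrite -big_mkcond /= (bigD1 u) //= {1}/b eqxx add0r.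
  have -> : i - 1 = \sum_(v in T | v != u) 1.
    by rewrite /i -sum1_card natr_sum (bigD1 u) //= addrAC subrr add0r.
  by apply: ler_sum => v _; rewrite /b; case: (_ && _); rewrite /= ?lexx ?ler01.
(* Every entry is first counted with [2 * a], then those in [T] are corrected by [2 * a - a ^+ 2],
   nonnegative as [a <= 2]. Inserting [row_sum] and [row_sumT] gives exactly [r]. *)
have -> : \sum_v 2 * w u v * b u v =
    2 * a * \sum_v b u v - (2 * a - a ^+ 2) * \sum_v (if v \in T then b u v else 0).
  rewrite !mulr_sumr -sumrB; apply: eq_bigr => v _; rewrite /w uT.
  by case: ifP => _; field.
have aa : 0 <= 2 * a - a ^+ 2 by rewrite expr2 -mulrBl mulr_ge0 // subr_ge0.
rewrite -subr_ge0 in row_sum; rewrite -subr_ge0 in row_sumT.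
have := mulr_ge0 a0 row_sum; have := mulr_ge0 aa row_sumT; rewrite /r.
lra.
Qed.

(** * Upper bound for the extremal graph *)

Lemma sum_extremal_blocks (R : realFieldType) (n d : nat) (p q r : R) :
  (0 < d)%N -> (2 * d <= n + 1)%N ->
  \sum_(i < n) (if (i < d)%N then p else if (i < n - d + 1)%N then q else r) =
  d%:R * p + (n%:R - 2 * d%:R + 1) * q + (d%:R - 1) * r.
Proof.
move=> d0 dn.
rewrite -(big_mkord xpredT (fun i => if (i < d)%N then p else if (i < n - d + 1)%N then q else r)).
have h1 : (d <= n - d + 1)%N by lia.
have h2 : (n - d + 1 <= n)%N by lia.
rewrite (big_cat_nat (leq0n d) (leq_trans h1 h2)) (big_cat_nat h1 h2) /= addrA.
have const (m1 m2 : nat) (f : nat -> R) c : (m1 <= m2)%N ->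
    (forall i, (m1 <= i < m2)%N -> f i = c) -> \sum_(m1 <= i < m2) f i = (m2%:R - m1%:R) * c.
  move=> le h; rewrite (eq_big_nat _ _ h) sumr_const_nat -natrB //.
  by rewrite [RHS]mulr_natl.
rewrite (const _ _ _ p) //; last by move=> i /andP[_ ->].
rewrite (const _ _ _ q) //; last by move=> i /andP[h3 h4]; rewrite ltnNge h3 h4.
rewrite (const _ _ _ r) //; last first.
  by move=> i /andP[h3 _]; rewrite !ltnNge h3 (leq_trans h1 h3).
rewrite natrD natrB; last lia.
ring.
Qed.

(* The weights z, 1, c on the three vertex classes solve the eigenvalue equations
   of D + I for the eigenvalue mu, once the total weight is replaced by its upper
   bound mu - t * c; this replacement is legitimate exactly when the cubic
   inequality holds. *)
Lemma rhoD_extremal_le (R : realType) n d (mu : R) (N := n%:R : R) (t := d%:R - 1 : R) :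
  (2 <= d)%N -> (2 * d + 2 <= n)%N -> N <= mu ->
  t * (mu + N - 2 * t - 1) * (2 * mu - t - 1) <= mu * (mu + 1) * (mu - N + t) ->
  rhoD R (extremal_graph n d) <= mu - 1.
Proof.
move=> d2 dn Nmu cubic.
have n2 : (2 < n)%N by lia.
have dn1 : (2 * d <= n + 1)%N by lia.
have d2R : 2 <= d%:R :> R by rewrite (ler_nat R 2).
have t1 : 1 <= t by rewrite /t; lra.
have tN : 2 * t + 4 <= N.
  have : (2 * d + 2)%:R <= n%:R :> R by rewrite ler_nat.
  by rewrite natrD natrM /t /N; lra.
have mu0 : 0 < mu by lra.
have mu1 : 0 < mu + 1 by lra.
(* With total weight [S = mu - t * c], the three equations read [mu * z = S], [mu = S + t * c] and
   [mu * c = S + (N - 2 * t - 1) + (t - 1) * c]; the last one determines [c]. *)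
pose c := (mu + N - 2 * t - 1) / (mu + 1).
pose z := (mu - t * c) / mu.
have cE : c * (mu + 1) = mu + N - 2 * t - 1 by rewrite /c divfK // gt_eqF.
have zE : mu * z = mu - t * c by rewrite /z mulrCA divff ?mulr1 // gt_eqF.
have c0 : 0 < c by apply: divr_gt0 => //; lra.
have c2 : c <= 2 by rewrite /c ler_pdivrMr //; lra.
have z0 : 0 < z.
  apply: divr_gt0 => //.
  have : t * c <= t * 2 by apply: ler_wpM2l => //; lra.
  lra.
pose S := d%:R * z + (N - 2 * d%:R + 1) * 1 + (d%:R - 1) * c.
have S_le : S <= mu - t * c.
  rewrite -subr_ge0.
  have -> : mu - t * c - S = (mu * (mu + 1) * (mu - N + t) -
      t * (mu + N - 2 * t - 1) * (2 * mu - t - 1)) / (mu * (mu + 1)).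
    rewrite /S /z /c (_ : d%:R = t + 1); last by rewrite /t; ring.
    by field; rewrite !gt_eqF.
  by apply: divr_ge0; [rewrite subr_ge0|apply: mulr_ge0; exact: ltW].
pose blk (p q r : R) (i : 'I_n) : R :=
  if (i < d)%N then p else if (i < n - d + 1)%N then q else r.
(* [B] bounds the terms of column [j] of [D + I]; the diagonal contributes [y j], which is
   subtracted at the end. *)
have row (y B : 'I_n -> R) j : B j = y j ->
    (forall i, i != j -> y i * (dist (extremal_graph n d) i j)%:R <= B i) ->
    \sum_i y i * (dist (extremal_graph n d) i j)%:R <= \sum_i B i - y j.
  move=> Bj hB; rewrite (bigD1 j) //= distxx mulr0 add0r [X in _ <= X - _](bigD1 j) //=.
  by rewrite Bj addrAC subrr add0r; apply: ler_sum => i /hB.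
pose v0 : 'I_n := Ordinal (ltnW (ltnW n2)).
have d_adj (i j : 'I_n) : i != j ->
    ((i < d) || (j < d) || ((i < n - d + 1) && (j < n - d + 1)))%N ->
    ((dist (extremal_graph n d) i j)%:R <= 1 :> R).
  move=> ij h; rewrite (ler_nat R _ 1); apply: dist_adj; first exact: ltnW.
  by rewrite /extremal_graph ij orbA.
(* The vertex [v0] lies in the clique [K_d] and is a common neighbour of any two vertices outside
   it. *)
have adj0 (k : 'I_n) : (d <= k)%N ->
    extremal_graph n d k v0 && extremal_graph n d v0 k.
  move=> dk; have d0 : (v0 < d)%N by exact: ltnW.
  have k0 : k != v0 by rewrite -val_eqE -lt0n; exact: leq_trans d0 dk.
  by rewrite /extremal_graph (eq_sym v0) k0 d0 orbT.
have d_2 (i j : 'I_n) : i != j -> (dist (extremal_graph n d) i j)%:R <= 2 :> R.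
  move=> ij; case h : ((i < d) || (j < d))%N.
    by apply: le_trans (d_adj i j ij _) _; [rewrite h|lra].
  move/norP: (negbT h); rewrite -!leqNgt => -[/adj0/andP[e1 _] /adj0/andP[_ e2]].
  by rewrite (ler_nat R _ 2); exact: dist_le2 e1 e2.
apply: (@rhoD_le R n _ (blk z 1 c)) => [|i|j]; first lra.
  by rewrite /blk; case: ifP => // _; case: ifP.
have sumS p q r : \sum_i blk p q r i =
    d%:R * p + (N - 2 * d%:R + 1) * q + (d%:R - 1) * r.
  by apply: sum_extremal_blocks => //; exact: ltnW.
have blk0 i : 0 <= blk z 1 c i by rewrite /blk; case: ifP => _; [|case: ifP => _]; lra.
case jd: (j < d)%N.
  have yj : blk z 1 c j = z by rewrite /blk jd.
  apply: le_trans (row _ (blk z 1 c) j _ _) _ => //.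
    move=> i ij; rewrite -[leRHS]mulr1 ler_wpM2l // d_adj // jd orbT //.
  rewrite sumS yj -/S mulrBl mul1r zE; lra.
case jn: (j < n - d + 1)%N.
  have yj : blk z 1 c j = 1 by rewrite /blk jd jn.
  apply: le_trans (row _ (blk z 1 (2 * c)) j _ _) _ => //; first by rewrite /blk jd jn.
    move=> i ij; have := d_2 i j ij; have := d_adj i j ij; rewrite jd jn andbT /blk.
    case: ifP => /= [_ /(_ isT) h _|_]; first by rewrite -[leRHS]mulr1 ler_wpM2l // ltW.
    case: ifP => /= [_ /(_ isT) h _|_ _ h]; first by rewrite mul1r.
    by rewrite [2 * c]mulrC ler_wpM2l // ltW.
  rewrite sumS yj mulr1; move: S_le; rewrite /S /t; lra.
have yj : blk z 1 c j = c by rewrite /blk jd jn.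
(* An independent vertex is at distance at most 2 from everything outside [K_d]; the subtracted [c]
   restores the diagonal weight of [j] itself. *)
apply: le_trans (row _ (fun i => blk z 2 (2 * c) i - (if i == j then c else 0)) j _ _) _.
- by rewrite /blk jd jn eqxx; ring.
- move=> i ij; rewrite (negbTE ij) subr0.
  have := d_2 i j ij; have := d_adj i j ij; rewrite jd jn andbF orbF /blk.
  case: ifP => /= [_ /(_ isT) h _|_ _ h]; first by rewrite -[leRHS]mulr1 ler_wpM2l // ltW.
  case: ifP => _; first by rewrite mul1r.
  by rewrite [2 * c]mulrC ler_wpM2l // ltW.
rewrite sumrB sumS -big_mkcond big_pred1_eq yj.
move: S_le; rewrite /S.
have : c * mu = mu + N - 2 * t - 1 - c by rewrite -cE; ring.
rewrite /t; lra.
Qed.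

Theorem theorem1p2 (R : realType) (d n : nat) (e : rel 'I_n) :
  (2 <= d)%N ->
  simple_graph e -> connected_graph e -> ~~ odd n ->
  min_degree_is e d ->
  (8 * d - 7 <= n)%N ->
  (d%:R ^+ 2 / 3 + 3 <= n%:R :> R) ->
  rhoD R e <= rhoD R (extremal_graph n d) ->
  ~ graph_iso e (extremal_graph n d) ->
  has_even_factor e.
Proof.
move=> d2 [sym irr] _ n_even [deg_ge _] nd nd2 rho_le _; apply: contrapT => no_factor.
(* As [n] is even and [8 * d - 7] is odd, the bound improves by one. *)
have nd' : (8 * (d - 1) + 2 <= n)%N by lia.
have n2 : (2 < n)%N by lia.
have not_ham : ~ hamiltonian e.
  by move=> ham; apply: no_factor; exact: hamiltonian_even_factor ham.
have n2' : (2 < #|'I_n|)%N by rewrite card_ord.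
have [T [dT T2 degT]] := posa_obstruction sym irr n2' not_ham deg_ge.
rewrite card_ord in T2.
have Tn : (#|T| < n)%N by lia.
(* Parity again: an even number below the even [n] is at most [n - 2], which places [#|T|] within
   the window. *)
have T2' : ((#|T| + 1).*2 <= n)%N by lia.
have dn : (2 * d + 2 <= n)%N by lia.
pose N : R := n%:R; pose t : R := d%:R - 1.
have tE : t + 1 = d%:R by rewrite /t; ring.
have t1 : 1 <= t.
  by have : 2 <= d%:R :> R; [rewrite (ler_nat R 2)|rewrite /t; lra].
have Nt : 8 * t + 2 <= N.
  have : (8 * (d - 1) + 2)%:R <= N by rewrite ler_nat.
  by rewrite natrD natrM natrB ?(ltnW d2).
have Nt2 : (t + 1) ^+ 2 + 9 <= 3 * N by rewrite tE /N; lra.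
have [mu [a [Nmu cubic a02 win]]] := spectral_window t1 Nt Nt2.
have upper : rhoD R (extremal_graph n d) <= mu - 1 by exact: rhoD_extremal_le.
have lower : mu - 1 < rhoD R e; last first.
  by move: (lt_le_trans lower (le_trans rho_le upper)); rewrite ltxx.
have iT : t + 1 <= #|T|%:R <= N / 2 - 1.
  have : ((#|T| + 1).*2)%:R <= N by rewrite ler_nat.
  rewrite -muln2 natrM natrD => h; apply/andP; split; last lra.
  by rewrite tE ler_nat.
pose x v : R := if v \in T then a else 1.
have Ex2 : \sum_v x v ^+ 2 = N - #|T|%:R + a ^+ 2 * #|T|%:R.
  rewrite [RHS](_ : _ = #|T|%:R * a ^+ 2 + (N - #|T|%:R) * 1); last by ring.
  rewrite -sum_if_mem; apply: eq_bigr => v _; rewrite /x.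
  by case: ifP => _; rewrite ?expr1n.
apply: (rhoD_ge_rayleigh (x := x) _ sym) => //.
- exact: ltnW (ltnW n2).
- have /card_gt0P[v] : (0 < #|~: T|)%N by rewrite cardsCs finset.setCK card_ord subn_gt0.
  rewrite inE => vT; by exists v; rewrite /x (negbTE vT) oner_eq0.
rewrite Ex2.
have := low_degree_rayleigh (ltnW n2) sym irr a02 degT.
have := win _ iT; rewrite -/N -/(x _).
lra.
Qed.
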